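(* MaxDef (the algorithm with Steps 1–12 described in the context, which takes as input a $3$-chromatic signed graph) is a polynomial-time algorithm if the signed graph is without multiple edges of the same sign and is input as a vertex list and two edge lists.
   Context: **Definitions.** A signed graph $\Sigma=(V,E,\sigma)$ is a graph $(V,E)$ with a signature $\sigma:E\to\{+,-\}$; here it need not be simple. A proper coloration is a function $\kappa$ from $V$ to a color set such that $\kappa(a)\neq\sigma(e)\kappa(b)$ for every edge $e$ with endpoints $a,b$. The color set of size $2k$ is $\{\pm1,\dots,\pm k\}$ and that of size $2k+1$ is $\{\pm1,\dots,\pm k,0\}$. The chromatic number $\chi(\Sigma)$ is the size of the smallest color set with which $\Sigma$ can be properly colored; $\Sigma$ is $3$-chromatic if $\chi(\Sigma)=3$. A coloration is minimal if it is proper and its color set has size $\chi(\Sigma)$ (for a $3$-chromatic graph the color set is $\{1,-1,0\}$). The deficiency of a coloration is the number of unused colors of its color set, and $\operatorname{M}(\Sigma)$ is the maximum deficiency over all minimal proper colorations of $\Sigma$; for $3$-chromatic $\Sigma$ it is $0$ or $1$. $E^{+}$ and $E^{-}$ are the sets of positive and negative edges, $\Sigma^+$ is the subgraph of positive edges, and $V^+$ is the set of vertices incident with at least one positive edge. For a derived signed graph such as $\Sigma_1$, the notations $V_1$, $E_1^+$, $E_1^-$ have the corresponding meaning. A set of vertices is stable in $\Sigma$ if it induces a subgraph with no edges. A vertex cover of $E^+$ is a set of vertices meeting every edge of $E^+$; a stable cover is a vertex cover of $E^+$ that is stable in $\Sigma$. The vertex list has size $|V|$ and the two edge lists (positive edges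 and negative edges) have total size $|E^+|+|E^-|=|E|$; polynomial-time means that the running time is bounded by a polynomial in the size of the input. **The algorithm MaxDef.** Input: a $3$-chromatic, not necessarily simple, signed graph $\Sigma$; the algorithm works with two arrays of adjacency lists (positive adjacencies and negative adjacencies). Output: the maximum deficiency, $0$ or $1$, along with a stable vertex cover of $E^+$ if the maximum deficiency is $1$. Throughout, $S$ is a partial stable cover and $B$ is a list of vertices forbidden from $S$; initially $S=B=\emptyset$. Recovery information about which vertices have been identified together is stored. $N_-(v)$ is the set of vertices (of the current graph) negatively adjacent to $v$. ''$X\rightarrow Y$'' means replace $Y$ by $X$. ''$\operatorname{M}(\Sigma)=0$'' or ''$\operatorname{M}(\Sigma)=1$'' in a step means the algorithm ends with that answer. Step 1: Delete all vertices of $\Sigma$ not in $V^+$; call the result $\Sigma_{01}$. Step 2: Let $H_1,\dots,H_r$ be the connected components of $\Sigma_{01}^+$. If some $H_i$ is not bipartite, then $\operatorname{M}(\Sigma)=0$. Otherwise, let $A_i,B_i$ be the parts of the unique bipartition of $H_i$; collapse each $A_i$ to a vertex $a_i$ and each $B_i$ to a vertex $b_i$, eliminate multiple edges of the same sign, and delete the negative edge $a_ib_i$ if it exists. (Negative edges inside $A_i$ or $B_i$ become loops.) The result $\Sigma_{02}$ is a positive perfect matching with all other edges negative. For a matched pair $(a_i,b_i)$, $x_i$ denotes one vertex of the pair and $\bar x_i$ the other. Set $\Sigma_1=\Sigma_{02}$. Step 3: If there is an $i$ with $x_i$ and $\bar x_i$ both in $B$, then $\operatorname{M}(\Sigma)=0$.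 Otherwise go to Step 4. Step 4: If there is an $i$ with $x_i\in B$, then $S\cup\{\bar x_i\}\rightarrow S$, $(B\cup N_-(\bar x_i))\setminus\{x_i\}\rightarrow B$, $\Sigma_1\setminus\{x_i,\bar x_i\}\rightarrow\Sigma_1$, and return to Step 3. Otherwise go to Step 5. Step 5: If there is an $i$ such that $x_i$ and $\bar x_i$ both have loops, then $\operatorname{M}(\Sigma)=0$. Otherwise go to Step 6. Step 6: If there is an $i$ such that $x_i$ has a loop, then $S\cup\{\bar x_i\}\rightarrow S$, $B\cup N_-(\bar x_i)\rightarrow B$, $\Sigma_1\setminus\{x_i,\bar x_i\}\rightarrow\Sigma_1$, and return to Step 3. Otherwise go to Step 7. Step 7: If there is an $i$ such that $x_i$ is adjacent to both $x_j$ and $\bar x_j$ (for some $j$), then $S\cup\{\bar x_i\}\rightarrow S$, $B\cup N_-(\bar x_i)\rightarrow B$, $\Sigma_1\setminus\{x_i,\bar x_i\}\rightarrow\Sigma_1$, and return to Step 3. Otherwise go to Step 8. Step 8: If there are $i\neq j$ such that $x_i$ is adjacent to $x_j$ and $\bar x_i$ is adjacent to $\bar x_j$, then identify $x_i$ with $\bar x_j$ and $\bar x_i$ with $x_j$ in $\Sigma_1$ (removing duplicate edges of the same sign), delete the negative edge $x_i\bar x_i$, and return to Step 3. Otherwise go to Step 9. Step 9: If there is a vertex of degree one, call it $x_i$; then $S\cup\{x_i\}\rightarrow S$, $B\cup N_-(x_i)\rightarrow B$, $\Sigma_1\setminus\{x_i,\bar x_i\}\rightarrow\Sigma_1$ (if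 $x_i$ and $\bar x_i$ both have degree one, only one of them, it does not matter which, is placed in $S$), and return to Step 3. Otherwise go to Step 10. Step 10: If $\Sigma_1$ is the empty graph, then $\operatorname{M}(\Sigma)=1$; use the recovery information to produce a stable cover of $E^+$. Otherwise go to Step 11. Step 11: Create the forcing graph $F(\Sigma_1)$, the directed graph with vertex set $V_1$ and directed edge set $\{x_ix_j : x_i\bar x_j\in E_1^-\}$. Since $\Sigma_1$ has no vertices of degree one, $F(\Sigma_1)$ has minimum outdegree at least $1$, so it contains a directed cycle; and since $x_ix_j$ is an edge if and only if $\bar x_j\bar x_i$ is, there are two cycles, possibly not disjoint: if one uses vertices $x_1,\dots,x_r$, the other uses $\bar x_1,\dots,\bar x_r$. Find such a pair of cycles. Step 12: If the two cycles found in Step 11 are not disjoint, then $\operatorname{M}(\Sigma)=0$. If they are disjoint, identify in $\Sigma_1$ the vertices belonging to each of the two cycles (each cycle to one vertex), eliminate multiple edges of the same sign, delete any negative edge $x_i\bar x_i$, let the result be the new $\Sigma_1$, and return to Step 3. **Data format.** During the run, the signed graph is stored as two arrays of adjacency lists, one for positive and one for negative edges (the positive lists are no longer updated after Step 2); the current forcing graph is stored as adjacency lists; $S$ and $B$ are stored as lists; the recovery information is stored as an array of lists, one list for each group of identified vertices. Adding, moving, changing or deleting a list element takes constant time. Bipartiteness in Step 2 and a cycle of the forcing graph are found by depth-first search. *)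

(* Defs.v *)
From mathcomp Require Import all_boot all_order all_algebra.

Set Implicit Arguments.
Unset Strict Implicit.
Unset Printing Implicit Defensive.

(* Multiple edges and loops are allowed.  The order of the two components of
   [ends e] is immaterial; a loop has equal components. *)
Record sgraph := SGraph {
  vertex : finType;
  edge : finType;
  ends : edge -> vertex * vertex;
  is_positive : pred edge
}.

Definition same_ends (V : eqType) (p q : V * V) : bool :=
  (p == q) || (p == (q.2, q.1)).

Definition no_multiple_edges_of_same_sign (G : sgraph) : Prop :=
  forall e f : edge G,
    is_positive e = is_positive f -> same_ends (ends e) (ends f) -> e = f.

Section Coloration.
Local Open Scope ring_scope.

Definition edge_sign (G : sgraph) (e : edge G) : int :=
  if is_positive e then 1 else -1.

Definition color_set (n : nat) : seq int :=
  [seq i%:Z | i <- iota 1 n./2] ++ [seq - i%:Z | i <- iota 1 n./2]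
    ++ (if odd n then [:: 0] else [::]).

Definition proper_coloration (G : sgraph) (kappa : vertex G -> int) : Prop :=
  forall e : edge G, kappa (ends e).1 <> edge_sign e * kappa (ends e).2.

Definition colorable (G : sgraph) (n : nat) : Prop :=
  exists kappa : vertex G -> int,
    (forall v, kappa v \in color_set n) /\ proper_coloration kappa.

End Coloration.

Definition chromatic_number_is (G : sgraph) (n : nat) : Prop :=
  colorable G n /\ forall m, colorable G m -> n <= m.

(* [vs], [ep], [en] list the vertices, the positive edges and the negative
   edges, each exactly once and in any order. *)
Definition input_of (G : sgraph) (vs : seq (vertex G))
    (ep en : seq (vertex G * vertex G)) : Prop :=
  [/\ perm_eq vs (enum (vertex G)),
      perm_eq ep [seq ends e | e <- enum (edge G) & is_positive e]
    & perm_eq en [seq ends e | e <- enum (edge G) & ~~ is_positive e]].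

(* A computation receives the number of time units it may still spend; it
   returns its result together with the time units left, or [None] if the time
   is exhausted (or if it has to choose from an empty list).  The following take
   one unit each: comparing two vertices, reading or writing an array cell,
   adding an element at the front of a list, advancing to the next element of a
   list, entering the body of a loop, and making an arbitrary binary decision.
   Between two of these a program below does only a bounded number of case
   distinctions, returns, and accesses to the first element of a list. *)
Definition timed (A : Type) : Type := nat -> option (A * nat).

Definition halts_within (A : Type) (c : timed A) (n : nat) : Prop :=
  exists a t, c n = Some (a, t).

Definition ret (A : Type) (a : A) : timed A := fun t => Some (a, t).

Definition bind (A B : Type) (c : timed A) (k : A -> timed B) : timed B :=
  fun t => if c t is Some (a, t') then k a t' else None.

Notation "'let*' x := c 'in' k" := (bind c (fun x => k))
  (at level 200, x pattern, c at level 200, k at level 200,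
   right associativity).

Definition tick : timed unit := fun t => if t is t'.+1 then Some (tt, t') else None.

Definition stuck (A : Type) : timed A := fun _ => None.
Arguments stuck {A}.

(* [body] either continues with a new state ([inl]) or ends the loop ([inr]).
   Every round spends a unit, so the recursion on the time left never stops a
   loop that has time left. *)
Fixpoint loop_rec (S R : Type) (body : S -> timed (S + R)) (fuel : nat) (s : S)
    : timed R :=
  if fuel is fuel'.+1 then
    let* _ := tick in
    let* r := body s in
    match r with
    | inl s' => loop_rec body fuel' s'
    | inr a => ret a
    end
  else stuck.

Definition loop (S R : Type) (body : S -> timed (S + R)) (s : S) : timed R :=
  fun t => loop_rec body t s t.

Fixpoint for_each (T S : Type) (f : T -> S -> timed S) (l : seq T) (s : S) : timed S :=
  if l is x :: l' then
    let* _ := tick in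
    let* s' := f x s in
    for_each f l' s'
  else ret s.

Definition push (T : Type) (x : T) (l : seq T) : timed (seq T) :=
  let* _ := tick in ret (x :: l).

Fixpoint select (T : Type) (p : T -> timed bool) (l : seq T) : timed (seq T) :=
  if l is x :: l' then
    let* _ := tick in
    let* b := p x in
    let* l'' := select p l' in
    if b then push x l'' else ret l''
  else ret [::].

Fixpoint exists_in (T : Type) (p : T -> timed bool) (l : seq T) : timed bool :=
  if l is x :: l' then
    let* _ := tick in
    let* b := p x in
    if b then ret true else exists_in p l'
  else ret false.

Definition map_list (T U : Type) (f : T -> timed U) (l : seq T) : timed (seq U) :=
  let* r := for_each (fun x r => let* y := f x in push y r) l [::] in
  for_each (@push U) r [::].

(* The steps of the algorithm say "if there is an i such that" without fixing
   which one is taken.  The decision made when [t] time units are left is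
   [omega t]; as time strictly decreases, letting [omega] range over all
   functions gives all possible runs. *)
Definition decide (omega : nat -> bool) : timed bool :=
  fun t => if t is t'.+1 then Some (omega t, t') else None.

Fixpoint choose_from (omega : nat -> bool) (T : Type) (l : seq T) : timed T :=
  match l with
  | [::] => stuck
  | [:: x] => let* _ := tick in ret x
  | x :: l' =>
      let* b := decide omega in
      if b then ret x else choose_from omega l'
  end.

(* [Answer1 C] is the answer M = 1 with the stable cover listed by [C]. *)
Inductive answer (V : Type) : Type :=
| Answer0
| Answer1 (cover : seq V).
Arguments Answer0 {V}.

Section MaxDef.
Variable (omega : nat -> bool) (V : eqType).

Notation array := (V -> seq V).

Definition eqv (x y : V) : timed bool := let* _ := tick in ret (x == y).

Definition get (a : array) (x : V) : timed (seq V) := let* _ := tick in ret (a x).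

Definition put (a : array) (x : V) (l : seq V) : timed array :=
  let* _ := tick in ret (fun y => if y == x then l else a y).

(* The first element of the list [a x], or [x] itself if that list is empty. *)
Definition first_of (a : array) (x : V) : timed V :=
  let* l := get a x in ret (head x l).

Definition member (x : V) (l : seq V) : timed bool := exists_in (eqv x) l.

Definition insert (x : V) (l : seq V) : timed (seq V) :=
  let* b := member x l in if b then ret l else push x l.

Definition union (l1 l2 : seq V) : timed (seq V) := for_each insert l1 l2.

Definition remove (x : V) (l : seq V) : timed (seq V) :=
  select (fun y => let* b := eqv x y in ret (~~ b)) l.

Definition new_array (f : V -> seq V) (vs : seq V) : timed array :=
  for_each (fun v a => put a v (f v)) vs (fun=> [::]).

Definition add_edge (e : V * V) (adj : array) : timed array :=
  let: (x, y) := e in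
  let* lx := get adj x in
  let* lx' := push y lx in
  let* adj' := put adj x lx' in
  let* b := eqv x y in
  if b then ret adj'
  else
    let* ly := get adj' y in
    let* ly' := push x ly in
    put adj' y ly'.

Definition adjacency (vs : seq V) (es : seq (V * V)) : timed array :=
  let* adj := new_array (fun=> [::]) vs in
  for_each add_edge es adj.

(* Restricts the adjacency lists of the vertices in [vs] to neighbours
   satisfying [keep]. *)
Definition restrict (keep : V -> timed bool) (vs : seq V) (adj : array)
    : timed array :=
  for_each (fun v a =>
          let* l := get a v in
          let* l' := select keep l in
          put a v l') vs adj.

(* Replaces each vertex [v] of [vs] by [first_of rep v]; vertices with the same
   replacement are thereby identified.  Multiple negative edges are removed, and
   so are the negative edges joining a vertex to its partner, the first entry of
   its list in [pos].  Returns the new vertices, the new negative lists, and the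
   updated recovery information [grp]. *)
Definition identify (pos rep : array) (vs : seq V) (neg grp : array)
    : timed (seq V * array * array) :=
  let* vs' := select (fun v => let* p := first_of rep v in eqv v p) vs in
  let* neg0 := new_array (fun=> [::]) vs' in
  let* neg' :=
    for_each (fun v a =>
      let* p := first_of rep v in
      let* p' := first_of pos p in
      let* nv := get neg v in
      for_each (fun w a =>
        let* q := first_of rep w in
        let* b := eqv q p' in
        if b then ret a
        else
          let* l := get a p in
          let* l' := insert q l in
          put a p l') nv a) vs neg0 in
  let* grp' :=
    for_each (fun v g =>
      let* p := first_of rep v in
      let* b := eqv v p in
      if b then ret g
      else
        let* gv := get g v in
        let* gp := get g p in
        let* l := union gv gp in
        put g p l) vs grp in
  ret (vs', neg', grp').

(* Depth-first search of a positive component.  An entry [(u, p, q)] of the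
   stack says that [u] is to be visited and has to belong to the part whose
   replacement is [p], the opposite part having replacement [q]; [rep u] is
   empty as long as [u] is unvisited.  The result is [None] if the component is
   not bipartite. *)
Definition dfs (pos : array) (stack : seq (V * V * V)) (rep : array)
    : timed (option array) :=
  loop (fun st : seq (V * V * V) * array =>
    let: (stack, rep) := st in
    match stack with
    | [::] => ret (inr (Some rep))
    | (u, p, q) :: stack' =>
        let* r := get rep u in
        match r with
        | p' :: _ =>
            let* b := eqv p p' in
            if b then ret (inl (stack', rep)) else ret (inr None)
        | [::] =>
            let* rep' := put rep u [:: p] in
            let* nu := get pos u in
            let* stack'' := for_each (fun w s => push (w, q, p) s) nu stack' in
            ret (inl (stack'', rep'))
        end
    end) (stack, rep).

(* Every vertex in [vs] has a positive neighbour.  The part of a root [v] is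
   collapsed to [v], and the opposite part to the first neighbour [w] of [v].
   Returns the replacement array and the list of pairs [(a_i, b_i)], or [None]
   if some component is not bipartite. *)
Definition bipartition (pos : array) (vs : seq V)
    : timed (option (array * seq (V * V))) :=
  let* rep0 := new_array (fun=> [::]) vs in
  for_each (fun v acc =>
    match acc with
    | None => ret None
    | Some (rep, pairs) =>
        let* r := get rep v in
        if r is _ :: _ then ret acc
        else
          let* w := first_of pos v in
          let* b := eqv v w in
          if b then ret None
          else
            let* o := dfs pos [:: (v, v, w)] rep in
            match o with
            | None => ret None
            | Some rep' =>
                let* pairs' := push (v, w) pairs in
                ret (Some (rep', pairs'))
            end
    end) vs (Some (rep0, [::])).

(* The data that change after Step 2: the vertices and negative adjacency lists
   of the current graph, the lists S and B, and the recovery information, where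
   [groups v] lists the vertices of the input identified to [v]. *)
Record state := State {
  verts : seq V;
  neg : array;
  partial_cover : seq V;
  forbidden : seq V;
  groups : array
}.

(* Returns the (now constant) positive adjacency lists and the
   initial state, or [None] if the answer is M = 0. *)
Definition preparation (vs : seq V) (ep en : seq (V * V))
    : timed (option (array * state)) :=
  let* pos := adjacency vs ep in
  let* neg := adjacency vs en in
  let* grp := new_array (fun v => [:: v]) vs in
  (* Step 1: only vertices incident with a positive edge are kept. *)
  let in_Vplus v := let* l := get pos v in ret (~~ nilp l) in
  let* vs01 := select in_Vplus vs in
  let* neg01 := restrict in_Vplus vs01 neg in
  (* Step 2: the parts of the positive components are collapsed. *)
  let* o := bipartition pos vs01 in
  match o with
  | None => ret None
  | Some (rep, pairs) =>
      let* pos02 :=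
        for_each (fun ab p =>
          let: (a, b) := ab in
          let* p' := put p a [:: b] in
          put p' b [:: a]) pairs pos in
      let* r := identify pos02 rep vs01 neg01 grp in
      let: (vs02, neg02, grp02) := r in
      ret (Some (pos02, State vs02 neg02 [::] [::] grp02))
  end.

Section Rounds.
(* [pos x] has the partner of [x] in the positive matching as only element. *)
Variable pos : array.

Definition partner (x : V) : timed V := first_of pos x.

(* Puts [y] into S and its negative neighbours into B, and deletes [y] and its
   partner from the graph. *)
Definition put_in_cover (y : V) (st : state) : timed state :=
  let: State vs neg cov forb grp := st in
  let* y' := partner y in
  let* ny := get neg y in
  let* cov' := push y cov in
  let* forb' := union ny forb in
  let keep v :=
    let* b := eqv v y in
    let* b' := eqv v y' in
    ret (~~ b && ~~ b') in
  let* vs' := select keep vs in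
  let* neg' := restrict keep vs' neg in
  ret (State vs' neg' cov' forb' grp).

Definition identify_in (rep : array) (st : state) : timed state :=
  let: State vs neg cov forb grp := st in
  let* r := identify pos rep vs neg grp in
  let: (vs', neg', grp') := r in
  ret (State vs' neg' cov forb grp').

Definition forcing_graph (vs : seq V) (neg : array) : timed array :=
  for_each (fun x F =>
    let* nx := get neg x in
    let* out := map_list partner nx in
    put F x out) vs (fun=> [::]).

(* The elements of [path] up to and including [v]. *)
Fixpoint up_to (v : V) (path : seq V) : timed (seq V) :=
  if path is u :: path' then
    let* _ := tick in
    let* b := eqv u v in
    if b then push u [::]
    else
      let* l := up_to v path' in
      push u l
  else ret [::].

(* Depth-first search for a directed cycle.  [path] is the stack of visited
   vertices, the latest one first, and [v] is the vertex reached next.  As every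
   vertex has an out-neighbour, the search finds a cycle before it would have to
   retreat for the first time. *)
Definition find_cycle (F : array) (root : V) : timed (seq V) :=
  loop (fun pv : seq V * V =>
    let: (path, v) := pv in
    let* b := member v path in
    if b then
      let* c := up_to v path in
      ret (inr c)
    else
      let* out := get F v in
      let* w := choose_from omega out in
      let* path' := push v path in
      ret (inl (path', w))) ([::], root).

(* One passage from Step 3 to the next return to Step 3, or to the end.  In
   these steps an index i together with one of the two vertices of its pair is
   the same thing as a vertex of the current graph. *)
Definition round (st : state) : timed (state + answer V) :=
  let: State vs neg cov forb grp := st in
  let in_B x := member x forb in
  let has_loop x := let* l := get neg x in member x l in
  let continue_with c := let* st' := c in ret (inl st') in
  (* Step 3: are both vertices of a pair forbidden? *)
  let* both_forbidden :=
    exists_in (fun x =>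
      let* b := in_B x in
      let* x' := partner x in
      let* b' := in_B x' in
      ret (b && b')) vs in
  if both_forbidden then ret (inr Answer0) else
  (* Step 4: a forbidden x puts its partner into S and leaves B. *)
  let* found := select in_B vs in
  if ~~ nilp found then
    continue_with (
      let* x := choose_from omega found in
      let* x' := partner x in
      let* st' := put_in_cover x' st in
      let: State vs1 neg1 cov1 forb1 grp1 := st' in
      let* forb2 := remove x forb1 in
      ret (State vs1 neg1 cov1 forb2 grp1))
  else
  (* Step 5: have both vertices of a pair a loop? *)
  let* both_loops :=
    exists_in (fun x =>
      let* b := has_loop x in
      let* x' := partner x in
      let* b' := has_loop x' in
      ret (b && b')) vs in
  if both_loops then ret (inr Answer0) else
  (* Step 6: x has a loop. *)
  let* found := select has_loop vs in
  if ~~ nilp found then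
    continue_with (
      let* x := choose_from omega found in
      let* x' := partner x in
      put_in_cover x' st)
  else
  (* Step 7: x is adjacent to both z and the partner of z. *)
  let* found :=
    select (fun x =>
      let* nx := get neg x in
      exists_in (fun z => let* z' := partner z in member z' nx) nx) vs in
  if ~~ nilp found then
    continue_with (
      let* x := choose_from omega found in
      let* x' := partner x in
      put_in_cover x' st)
  else
  (* Step 8: x is adjacent to z, and the partner of x to that of z, where x and
     z are in different pairs. *)
  let* found :=
    for_each (fun x acc =>
      let* nx := get neg x in
      let* x' := partner x in
      let* nx' := get neg x' in
      for_each (fun z acc =>
        let* z' := partner z in
        let* b := member z' nx' in
        let* same := eqv x z in
        let* opposite := eqv x z' in
        if [&& b, ~~ same & ~~ opposite] then push (x, z) acc else ret acc)
        nx acc) vs [::] in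
  if ~~ nilp found then
    continue_with (
      let* xz := choose_from omega found in
      let: (x, z) := xz in
      let* x' := partner x in
      let* z' := partner z in
      let* rep := new_array (fun v => [:: v]) vs in
      let* rep' := put rep z' [:: x] in
      let* rep'' := put rep' z [:: x'] in
      identify_in rep'' st)
  else
  (* Step 9: x has degree one, that is, no negative edge, since exactly one edge
     at each vertex is positive. *)
  let* found := select (fun x => let* nx := get neg x in ret (nilp nx)) vs in
  if ~~ nilp found then
    continue_with (
      let* x := choose_from omega found in
      put_in_cover x st)
  else
  (* Step 10: the graph is empty; the identified vertices are recovered. *)
  if nilp vs then
    let* cover :=
      for_each (fun x c => let* gx := get grp x in union gx c) cov [::] in
    ret (inr (Answer1 cover))
  else
  (* Step 11: a cycle of the forcing graph, and the cycle of the partners. *)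
  let* F := forcing_graph vs neg in
  let* root := choose_from omega vs in
  let* cycle := find_cycle F root in
  let* cycle' := map_list partner cycle in
  (* Step 12: each of the two cycles, if disjoint, becomes one vertex. *)
  let* meet := exists_in (fun x => member x cycle') cycle in
  if meet then ret (inr Answer0)
  else
    continue_with (
      let* rep := new_array (fun v => [:: v]) vs in
      let c := head root cycle in
      let* c' := partner c in
      let* rep' := for_each (fun x r => put r x [:: c]) cycle rep in
      let* rep'' := for_each (fun x r => put r x [:: c']) cycle' rep' in
      identify_in rep'' st).

End Rounds.

Definition MaxDef (vs : seq V) (ep en : seq (V * V)) : timed (answer V) :=
  let* o := preparation vs ep en in
  match o with
  | None => ret Answer0
  | Some (pos, st) => loop (round pos) st
  end.

End MaxDef.

(* Main.v *)
(* Let N be the input size.  Every round that does not end the algorithm removes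
   a vertex of the current graph: a pair of matched vertices is deleted, or the
   vertices to be identified are not all equal.  In Step 8 the latter holds as
   x_i and x_j lie in different pairs; in Step 12 the forcing graph has no loops,
   as no negative edge joins matched vertices, so a directed cycle has at least
   two vertices.  Hence there are at most N rounds, and a round is a bounded
   nesting of loops over duplicate-free lists of vertices.  Every run of the
   program therefore succeeds: choices are made from nonempty lists, because
   Step 9 leaves no vertex without a negative neighbour.  The invariants are set
   up by Step 2, where the symmetry of the positive adjacencies makes the
   representatives of distinct components distinct. *)
Require Import Defs.
From mathcomp Require Import all_boot all_order all_algebra.

Set Implicit Arguments.
Unset Strict Implicit.
Unset Printing Implicit Defensive.

(** * Running time of programs *)

(** The surplus [t] is universally quantified because choices depend on the time left; [t <= t']
    makes [n] an upper bound on the cost, so that bounds add up under [bind]. *)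
Definition runs (A : Type) (n : nat) (c : timed A) (Q : A -> Prop) : Prop :=
  forall t, exists a t', [/\ c (n + t) = Some (a, t'), t <= t' & Q a].

Lemma runs_le (A : Type) (m n : nat) (c : timed A) (P Q : A -> Prop) :
  m <= n -> runs m c P -> (forall a, P a -> Q a) -> runs n c Q.
Proof.
move=> le_mn run_c PQ t; have [a [t' [eq_c le_t Pa]]] := run_c (n - m + t).
exists a, t'; split; last exact: PQ.
  by rewrite -eq_c addnA subnKC.
exact: leq_trans (leq_addl _ _) le_t.
Qed.

Lemma runs_ret (A : Type) (n : nat) (a : A) (Q : A -> Prop) :
  Q a -> runs n (ret a) Q.
Proof. by move=> Qa t; exists a, (n + t); split=> //; exact: leq_addl. Qed.

Lemma runs_bind (A B : Type) (m n : nat) (c : timed A) (f : A -> timed B)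
    (P : A -> Prop) (Q : B -> Prop) :
  runs m c P -> (forall a, P a -> runs n (f a) Q) -> runs (m + n) (bind c f) Q.
Proof.
move=> run_c run_f t; have [a [t1 [eq_c le_t1 Pa]]] := run_c (n + t).
(* The first program leaves [t1 >= n + t] units, so the second one starts with surplus
   [t1 - n >= t]. *)
have [b [t2 [eq_f le_t2 Qb]]] := run_f a Pa (t1 - n).
exists b, t2; split=> //; last by apply: leq_trans le_t2; rewrite leq_subRL //
  (leq_trans (leq_addr _ _) le_t1).
by rewrite /bind -addnA eq_c -eq_f subnKC // (leq_trans (leq_addr _ _) le_t1).
Qed.

Lemma runs_tick (Q : unit -> Prop) : Q tt -> runs 1 tick Q.
Proof. by move=> Qt t; exists tt, t. Qed.

Lemma runs_tick_bind (A : Type) (n : nat) (f : unit -> timed A) (Q : A -> Prop) :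
  runs n (f tt) Q -> runs n.+1 (bind tick f) Q.
Proof.
by move=> run_f; apply: (runs_bind (P := xpredT)) (runs_tick _) _ => // -[].
Qed.

(** One unit is spent per decision, or per final singleton. Nothing is assumed about [omega], so
    both outcomes of a decision are followed. *)
Lemma runs_choose_from (omega : nat -> bool) (T : eqType) (l : seq T) :
  l != [::] -> runs (size l) (choose_from omega l) (fun x => x \in l).
Proof.
elim: l => // x [|y l] IHl _.
  by apply: runs_tick_bind; apply: runs_ret; rewrite mem_head.
move=> t; rewrite [choose_from _ _]/= /bind /=; case: (omega _).
  exists x, ((size l).+1 + t); split; rewrite ?mem_head //; exact: leq_addl.
have [z [t' [eq_z le_t z_l]]] := IHl isT t.
by exists z, t'; split; rewrite // inE z_l orbT.
Qed.

Lemma runs_for_each (T S : Type) (n : nat) (f : T -> S -> timed S)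
    (I : seq T -> S -> Prop) (l : seq T) (s : S) :
  I l s -> (forall x l' s', I (x :: l') s' -> runs n (f x s') (I l')) ->
  runs (size l * n.+1) (for_each f l s) (I [::]).
Proof.
move=> + run_f; elim: l s => [|x l IHl] s Is; first exact: runs_ret.
rewrite mulSn addSn; apply: runs_tick_bind.
by apply: runs_bind (run_f _ _ _ Is) _.
Qed.

(** The two extra units per element are the advance and the push made after the recursive call. *)
Lemma runs_select (T : eqType) (n : nat) (p : T -> timed bool) (P : pred T)
    (l : seq T) :
  {in l, forall x, runs n (p x) (fun b => b = P x)} ->
  runs (size l * n.+2) (select p l) (fun r => r = filter P l).
Proof.
elim: l => [|x l IHl] run_p; first exact: runs_ret.
rewrite mulSn addSn; apply: runs_tick_bind.
rewrite addSnnS; apply: runs_bind (run_p x (mem_head x l)) _ => _ /= ->.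
rewrite -addn1; apply: (runs_bind (IHl _)) => [y y_l|_ ->].
  by apply: run_p; rewrite inE y_l orbT.
case: (P x); last exact: runs_ret.
by apply: runs_tick_bind; apply: runs_ret.
Qed.

Lemma runs_exists_in (T : eqType) (n : nat) (p : T -> timed bool) (P : pred T)
    (l : seq T) :
  {in l, forall x, runs n (p x) (fun b => b = P x)} ->
  runs (size l * n.+1) (exists_in p l) (fun b => b = has P l).
Proof.
elim: l => [|x l IHl] run_p; first exact: runs_ret.
rewrite mulSn addSn; apply: runs_tick_bind.
apply: runs_bind (run_p x (mem_head x l)) _ => _ /= ->.
case: (P x); first exact: runs_ret.
by apply: IHl => y y_l; apply: run_p; rewrite inE y_l orbT.
Qed.

Lemma runs_loop (S R : Type) (m n : nat) (body : S -> timed (S + R))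
    (I : S -> Prop) (mu : S -> nat) (Q : R -> Prop) (s : S) :
  (forall s, I s -> runs n (body s) (fun r => match r with
     | inl s' => I s' /\ mu s' < mu s
     | inr a => Q a
     end)) ->
  I s -> mu s < m -> runs (m * n.+1) (loop body s) Q.
Proof.
move=> run_body Is lt_mu.
(* The fuel of [loop] is the time left, which is at least [m]; hence it outlasts the at most [m]
   rounds allowed by [mu]. *)
suff run_rec fuel : m <= fuel -> runs (m * n.+1) (loop_rec body fuel s) Q.
  move=> t; apply: run_rec.
  by rewrite (leq_trans _ (leq_addr _ _)) // leq_pmulr.
elim: m fuel s Is lt_mu => // m IHm [//|fuel] s Is lt_mu le_m.
rewrite mulSn addSn; apply: runs_tick_bind.
apply: runs_bind (run_body s Is) _ => -[s' [Is' lt_s']|a Qa]; last exact: runs_ret.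
by apply: IHm => //; apply: leq_trans lt_s' _.
Qed.

(** * Time bounds as powers of N + 2 *)

Section Levels.
Variable N : nat.

(* As the base of the power is at least 2 and exceeds N, two computations of
   level k one after the other, as well as N of them, have level k + 1.  The
   numerals used as levels below are not optimal. *)
Definition within (k : nat) (A : Type) (c : timed A) (Q : A -> Prop) : Prop :=
  runs (N.+2 ^ k) c Q.

Lemma doubled_level (k : nat) : N.+2 ^ k + N.+2 ^ k <= N.+2 ^ k.+1.
Proof. by rewrite addnn -mul2n expnS leq_mul2r orbT. Qed.

Lemma level_gt0 (k : nat) : 0 < N.+2 ^ k. Proof. by rewrite expn_gt0. Qed.

Lemma level_succ (k : nat) : (N.+2 ^ k).+1 <= N.+2 ^ k.+1.
Proof. by rewrite -addn1 (leq_trans _ (doubled_level k)) ?leq_add2l ?level_gt0. Qed.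

Lemma within_le (j k : nat) (A : Type) (c : timed A) (P Q : A -> Prop) :
  j <= k -> within j c P -> (forall a, P a -> Q a) -> within k c Q.
Proof. by move=> le_jk; apply: runs_le; rewrite leq_pexp2l. Qed.

Lemma within_ret (k : nat) (A : Type) (a : A) (Q : A -> Prop) :
  Q a -> within k (ret a) Q.
Proof. exact: runs_ret. Qed.

Lemma within_bind (j k : nat) (A B : Type) (c : timed A) (f : A -> timed B)
    (P : A -> Prop) (Q : B -> Prop) :
  within j c P -> j <= k -> (forall a, P a -> within k (f a) Q) ->
  within k.+1 (bind c f) Q.
Proof.
move=> run_c le_jk run_f; apply: runs_le (doubled_level k) _ (fun _ => id).
by apply: runs_bind run_f; apply: (within_le le_jk run_c).
Qed.

Lemma within_tick_bind (k : nat) (A : Type) (f : unit -> timed A) (Q : A -> Prop) :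
  within k (f tt) Q -> within k.+1 (bind tick f) Q.
Proof.
by move=> run_f; apply: runs_le (level_succ k) _ (fun _ => id); apply: runs_tick_bind.
Qed.

Definition yields (k : nat) (A : Type) (c : timed A) (a : A) : Prop :=
  within k c (fun a' => a' = a).

Lemma bind_yields (j k : nat) (A B : Type) (c : timed A) (a : A)
    (f : A -> timed B) (Q : B -> Prop) :
  yields j c a -> j <= k -> within k (f a) Q -> within k.+1 (bind c f) Q.
Proof. by move=> run_c le_jk run_f; apply: within_bind run_c le_jk _ => _ ->. Qed.

Lemma within_choose_from (k : nat) (omega : nat -> bool) (T : eqType) (l : seq T) :
  l != [::] -> size l <= N.+2 ^ k ->
  within k (choose_from omega l) (fun x => x \in l).
Proof. by move=> l_n0 le_l; apply: runs_le le_l (runs_choose_from _ l_n0) (fun _ => id). Qed.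

(** The two units added to each pass are absorbed by one level each, and the [n] passes by a
    third. *)
Lemma iterated_level (k n : nat) : n <= N -> n * (N.+2 ^ k).+2 <= N.+2 ^ k.+3.
Proof.
move=> le_n; rewrite [in leqRHS]expnS.
apply: leq_mul; first by apply: leq_trans le_n _; apply: leq_trans (leqnSn _) (leqnSn _).
by apply: leq_trans (level_succ k.+1); rewrite ltnS; apply: level_succ.
Qed.

Lemma within_for_each (k : nat) (T S : Type) (f : T -> S -> timed S)
    (I : seq T -> S -> Prop) (l : seq T) (s : S) :
  size l <= N -> I l s ->
  (forall x l' s', I (x :: l') s' -> within k (f x s') (I l')) ->
  within k.+3 (for_each f l s) (I [::]).
Proof.
move=> le_l Is run_f; apply: runs_le (runs_for_each Is run_f) (fun _ => id).
by apply: leq_trans (iterated_level k le_l); rewrite leq_mul2l leqnSn orbT.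
Qed.

Lemma within_for_each_in (k : nat) (T : eqType) (S : Type)
    (f : T -> S -> timed S) (I : S -> Prop) (l : seq T) (s : S) :
  size l <= N -> I s ->
  (forall x s', x \in l -> I s' -> within k (f x s') I) ->
  within k.+3 (for_each f l s) I.
Proof.
move=> le_l Is run_f.
apply: (within_le (leqnn _) (P := fun s => {subset [::] <= l} /\ I s)); last by move=> ? [].
apply: (within_for_each (I := fun l' s => {subset l' <= l} /\ I s)); [by []|by split|].
move=> x l' s' [sub_l Is'].
 apply: within_le (run_f _ _ (sub_l _ (mem_head _ _)) Is') _ => //.
by move=> s'' Is''; split=> // y y_l'; apply: sub_l; rewrite inE y_l' orbT.
Qed.

Lemma within_select (k : nat) (T : eqType) (p : T -> timed bool) (P : pred T)
    (l : seq T) :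
  size l <= N -> {in l, forall x, yields k (p x) (P x)} ->
  yields k.+3 (select p l) (filter P l).
Proof.
by move=> le_l run_p; apply: runs_le (iterated_level k le_l) (runs_select run_p) _.
Qed.

Lemma within_exists_in (k : nat) (T : eqType) (p : T -> timed bool) (P : pred T)
    (l : seq T) :
  size l <= N -> {in l, forall x, yields k (p x) (P x)} ->
  yields k.+3 (exists_in p l) (has P l).
Proof.
move=> le_l run_p; apply: runs_le (runs_exists_in run_p) _ => //.
by apply: leq_trans (iterated_level k le_l); rewrite leq_mul2l leqnSn orbT.
Qed.

Lemma within_loop (j k : nat) (S R : Type) (body : S -> timed (S + R))
    (I : S -> Prop) (mu : S -> nat) (Q : R -> Prop) (s : S) :
  (forall s, I s -> within k (body s) (fun r => match r with
     | inl s' => I s' /\ mu s' < mu s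
     | inr a => Q a
     end)) ->
  I s -> mu s < N.+2 ^ j -> within (j + k.+1) (loop body s) Q.
Proof.
move=> run_body Is lt_mu; apply: runs_le (runs_loop run_body Is lt_mu) (fun _ => id).
by rewrite expnD leq_mul2l level_succ orbT.
Qed.

Lemma within_runs (n k : nat) (A : Type) (c : timed A) (Q : A -> Prop) :
  n <= N.+2 ^ k -> runs n c Q -> within k c Q.
Proof. by move=> le_n run_c; apply: runs_le le_n run_c (fun _ => id). Qed.

(* Otherwise unification unfolds the powers of N + 2. *)
#[local] Opaque within.

(** * Costs of the operations on lists and arrays *)

Section Arrays.
Variable V : finType.
Hypothesis card_le : #|V| <= N.
Implicit Types (a : V -> seq V) (l : seq V) (x y : V).

Lemma uniq_size_le l : uniq l -> size l <= N.
Proof. by move=> /card_uniqP <-; apply: leq_trans card_le; apply: max_card. Qed.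

Lemma yields_get a x : yields 1 (get a x) (a x).
Proof. by apply: within_tick_bind; apply: within_ret. Qed.

Lemma yields_put a x l :
  yields 1 (put a x l) (fun y => if y == x then l else a y).
Proof. by apply: within_tick_bind; apply: within_ret. Qed.

Lemma yields_push (T : Type) (x : T) (l : seq T) : yields 1 (push x l) (x :: l).
Proof. by apply: within_tick_bind; apply: within_ret. Qed.

Lemma yields_eqv x y : yields 1 (eqv x y) (x == y).
Proof. by apply: within_tick_bind; apply: within_ret. Qed.

(** The value computed by [first_of]: the partner when [a] is the matching, the representative when
    [a] is a replacement array. An empty list makes [x] its own representative. *)
Definition mate a x := head x (a x).

Lemma yields_first_of a x : yields 2 (first_of a x) (mate a x).
Proof. by apply: bind_yields (yields_get a x) _ _ => //; apply: within_ret. Qed.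

Lemma yields_partner a x : yields 2 (partner a x) (mate a x).
Proof. exact: yields_first_of. Qed.

Lemma yields_member x l : size l <= N -> yields 4 (member x l) (x \in l).
Proof.
move=> le_l; have -> : (x \in l) = has (eq_op x) l.
  by rewrite -has_pred1; apply: eq_has => y; apply: eq_sym.
by apply: within_exists_in => // y _; apply: yields_eqv.
Qed.

#[local] Hint Resolve yields_get yields_put yields_push yields_eqv : cost.
#[local] Hint Resolve yields_first_of yields_partner yields_member uniq_size_le : cost.
(** Executes the leading instruction when its exact result is given by a cost lemma; the level of
    the goal drops by one. *)
Local Ltac run := eapply bind_yields; [solve [eauto with cost] | done | cbv beta].

Lemma yields_insert x l :
  size l <= N -> yields 6 (insert x l) (if x \in l then l else x :: l).
Proof.
move=> le_l; run; case: (x \in l); first exact: within_ret.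
exact: within_le (yields_push _ _) (fun _ => id).
Qed.
#[local] Hint Resolve yields_insert : cost.

Lemma within_union l1 l2 :
  size l1 <= N -> uniq l2 -> within 9 (union l1 l2) uniq.
Proof.
move=> le_l1 Ul2; apply: within_for_each_in => // x l _ Ul.
apply: within_le (yields_insert x (uniq_size_le Ul)) _ => // _ ->.
by case: ifPn => //= ->.
Qed.

Lemma yields_remove x l : size l <= N -> yields 5 (remove x l) [seq y <- l | x != y].
Proof. by move=> le_l; apply: within_select => // y _; run; apply: within_ret. Qed.

(** Outside [l] the cells keep the default empty list. For [f] constantly empty the two cases
    coincide, and for [f x = [:: x]] both give [mate a x = x]. *)
Lemma within_new_array f l :
  size l <= N ->
  within 4 (new_array f l) (fun a => forall x, a x = f x \/ a x = [::] /\ x \notin l).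
Proof.
move=> le_l.
pose I (r : seq V) (a : V -> seq V) := forall x, a x = f x \/ a x = [::] /\ ((x \notin l) || (x \in r)).
apply: (within_le (leqnn _) (P := I [::])) => [|a Ia x]; last first.
  by case: (Ia x) => [|[-> ]]; [left | rewrite orbF; right].
apply: within_for_each => // [x|x r a Ia]; first by right; rewrite orNb.
apply: within_le (yields_put _ _ _) _ => // _ -> y /=.
case: eqP (Ia y) => [-> _|y_neq [->|[-> ]]]; [by left|by left|].
by rewrite inE (introF eqP y_neq); right.
Qed.

Lemma yields_for_each_push (k : nat) (T U : Type) (f : T -> seq U -> timed (seq U))
    (g : T -> U) (ts : seq T) (us : seq U) :
  size ts <= N -> (forall t us', yields k (f t us') (g t :: us')) ->
  yields k.+3 (for_each f ts us) (catrev (map g ts) us).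
Proof.
move=> le_ts run_f.
apply: (within_for_each
  (I := fun r us' => catrev (map g r) us' = catrev (map g ts) us)) => // t r us' <-.
by apply: within_le (run_f t us') _ => // _ ->.
Qed.

Lemma yields_map_list (k : nat) (T U : Type) (f : T -> timed U) (g : T -> U)
    (ts : seq T) :
  size ts <= N -> (forall t, yields k.+1 (f t) (g t)) ->
  yields k.+4.+3 (map_list f ts) (map g ts).
Proof.
move=> le_ts run_f.
have run_push t us : yields k.+2 (let* u := f t in push u us) (g t :: us).
  by apply: bind_yields (run_f t) _ _ => //; apply: within_le (yields_push _ _) _.
apply: bind_yields (yields_for_each_push [::] le_ts run_push) _ _ => //.
(* The first pass builds the images in reverse order; the second pass of pushes restores it. *)
rewrite catrevE cats0; set us := rev _.
have le_us : size us <= N by rewrite size_rev size_map.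
have run_us := yields_for_each_push (g := id) [::] le_us (@yields_push U).
by apply: within_le run_us _ => // _ ->; rewrite map_id catrevE cats0 revK.
Qed.

(** * Operations on adjacency lists *)

Definition symmetric_lists a := forall x y, y \in a x -> x \in a y.

(** A loop is entered once, and the two updates for any other edge touch different cells, so no list
    grows by more than one. Symmetry serves the search of positive components. *)
Lemma within_add_edge (e : V * V) a :
  within 8 (add_edge e a) (fun a' =>
    (forall x, size (a' x) <= (size (a x)).+1) /\
    (symmetric_lists a -> symmetric_lists a')).
Proof.
case: e => x y; do 4 run; case: eqP => [<-|/eqP x_neq_y].
  apply: within_ret; split=> [z|sym_a z w]; first by case: eqP => [->|].
  case: eqP => [->|z_neq]; case: eqP => [->|w_neq]; rewrite ?inE ?eqxx //.
  - by rewrite (introF eqP w_neq) => /sym_a.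
  - by move=> /sym_a ->; rewrite orbT.
  - exact: sym_a.
do 2 run; apply: within_le (yields_put _ _ _) _ => // _ ->.
have y_neq_x : y == x = false by rewrite eq_sym (negPf x_neq_y).
rewrite y_neq_x; split=> [z|sym_a z w].
  by case: eqP => [->|_] //; case: eqP => [->|].
have mem_new u v : u \in (if v == y then x :: a y else if v == x then y :: a x else a v)
    = [|| (v == y) && (u == x), (v == x) && (u == y) | u \in a v].
  case: (eqVneq v y) => [->|_]; first by rewrite inE y_neq_x.
  by case: eqVneq => [->|//]; rewrite inE.
rewrite !mem_new => /or3P[/andP[/eqP-> /eqP->]|/andP[/eqP-> /eqP->]|/sym_a ->].
- by rewrite !eqxx orbT.
- by rewrite !eqxx.
- by rewrite !orbT.
Qed.

Lemma within_adjacency l (es : seq (V * V)) :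
  size l <= N -> size es <= N ->
  within 12 (adjacency l es) (fun a =>
    (forall x, size (a x) <= N) /\ symmetric_lists a).
Proof.
move=> le_l le_es; apply: within_bind (within_new_array _ le_l) _ _ => // a0 a0E.
have {}a0E x : a0 x = [::] by case: (a0E x) => [|[]].
(* Each edge lengthens a list by at most one, so list length is traded against edges still to be
   read. *)
pose I (r : seq (V * V)) (a : V -> seq V) :=
  (forall x, size (a x) + size r <= N) /\ symmetric_lists a.
apply: (within_le (leqnn _) (P := I [::])) => [|a [le_a sym_a]]; last first.
  by split=> // x; rewrite -[size (a x)]addn0.
apply: within_for_each => // [|e r a [le_a sym_a]].
  by split=> [x|x y]; rewrite a0E.
apply: within_le (within_add_edge e a) _ => // a' [le_a' sym_a'].
split; last exact: sym_a'.
move=> x; apply: leq_trans (le_a x); rewrite /= addnS -addSn leq_add2r; exact: le_a'.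
Qed.

Lemma within_restrict (k : nat) (keep : V -> timed bool) (P : pred V) l a :
  (forall x, yields k (keep x) (P x)) ->
  size l <= N -> (forall x, size (a x) <= N) ->
  within k.+4.+4 (restrict keep l a) (fun a' =>
    (forall x, subseq (a' x) (a x)) /\ {in l, forall x, all P (a' x)}).
Proof.
move=> run_keep le_l le_a.
pose I (r : seq V) (a' : V -> seq V) :=
  (forall x, subseq (a' x) (a x)) /\ {in l, forall x, x \notin r -> all P (a' x)}.
apply: (within_le (leqnn _) (P := I [::])) => [|a' [sub_a' all_a']]; last first.
  by split=> // x x_l; apply: all_a'.
apply: within_for_each => // [|x r a' [sub_a' all_a']].
  by split=> // x ->.
have le_a'x : size (a' x) <= N by apply: leq_trans (size_subseq (sub_a' x)) (le_a x).
run; apply: bind_yields (within_select le_a'x (fun y _ => run_keep y)) _ _ => //.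
apply: within_le (yields_put _ _ _) _ => // _ ->; split=> [y|y y_l y_r].
  by case: eqP => // ->; apply: subseq_trans (filter_subseq _ _) (sub_a' x).
by case: eqP => [_|/eqP y_x]; rewrite ?filter_all // all_a' // inE negb_or y_x.
Qed.

Lemma within_put_all l l' a :
  size l <= N ->
  within 4 (for_each (fun x a => put a x l') l a)
    (fun a' => forall x, a' x = if x \in l then l' else a x).
Proof.
move=> le_l.
pose I (r : seq V) (a' : V -> seq V) :=
  forall x, (if x \in r then l' else a' x) = if x \in l then l' else a x.
apply: (within_for_each (I := I)) => // x r a' Ia'.
apply: within_le (yields_put _ _ _) _ => // _ -> y; rewrite -Ia' inE.
by case: eqP => //= _; rewrite if_same.
Qed.

(** Idempotence makes every replacement a fixed point of [rep], hence a surviving vertex, so the new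
    negative lists stay among the survivors. They are duplicate-free whatever repetitions [neg] has,
    because they grow only by [insert]. *)
Lemma within_identify (pos rep neg grp : V -> seq V) l :
  uniq l -> {in l, forall x, mate rep x \in l} ->
  {in l, forall x, mate rep (mate rep x) = mate rep x} ->
  (forall x, size (neg x) <= N) -> {in l, forall x, {subset neg x <= l}} ->
  (forall x, uniq (grp x)) ->
  within 22 (identify pos rep l neg grp) (fun r =>
    [/\ r.1.1 = [seq x <- l | x == mate rep x],
        forall x, uniq (r.1.2 x) /\ mate pos x \notin r.1.2 x,
        forall x, {subset r.1.2 x <= r.1.1}
      & forall x, uniq (r.2 x)]).
Proof.
move=> Ul rep_l repK le_neg neg_l Ugrp; have le_l := uniq_size_le Ul.
apply: (bind_yields (a := [seq x <- l | x == mate rep x]) (j := 6)) => //.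
  apply: within_select => // x _; run; exact: within_le (yields_eqv _ _) (fun _ => id).
set l' := [seq x <- l | _]; have Ul' : uniq l' by rewrite filter_uniq.
apply: within_bind (within_new_array _ (uniq_size_le Ul')) _ _ => // neg0 neg0E.
have {}neg0E x : neg0 x = [::] by case: (neg0E x) => [|[]].
pose I (a : V -> seq V) := forall x,
  [/\ uniq (a x), mate pos x \notin a x & {subset a x <= l'}].
apply: (within_bind (P := I) (j := 19)) => [||neg' neg'_I] //.
  apply: within_for_each_in => // [x|x a x_l Ia]; first by rewrite neg0E.
  do 3 run; apply: within_for_each_in => // y a' y_x Ia'.
  run; run; case: eqP => [_|/eqP rep_y]; first exact: within_ret.
  have [Ua' _ _] := Ia' (mate rep x).
  run; apply: bind_yields (yields_insert _ (uniq_size_le Ua')) _ _ => //.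
  apply: within_le (yields_put _ _ _) _ => // _ -> z.
  case: (eqVneq z (mate rep x)) => [->|_]; last exact: Ia'.
  have [_ a'_x a'_l'] := Ia' (mate rep x).
  case: ifP => // rep_y_a'; split=> /=; first by rewrite rep_y_a'.
    by rewrite inE negb_or eq_sym rep_y.
  have y_l := neg_l x x_l y y_x.
  move=> w; rewrite inE => /orP[/eqP->|/a'_l' //].
  by rewrite mem_filter repK ?eqxx ?rep_l.
apply: (within_bind (P := fun g => forall x, uniq (g x)) (j := 17)) => [||grp' Ugrp'] //.
  apply: within_for_each_in => // x g x_l Ug.
  run; run; case: ifP => _; first exact: within_ret.
  do 2 run; apply: within_bind (within_union (uniq_size_le (Ug _)) (Ug _)) _ _ => // gp Ugp.
  by apply: within_le (yields_put _ _ _) _ => // _ -> y; case: eqP.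
by apply: within_ret; split=> // x; have [? ? ?] := neg'_I x.
Qed.

(** * The rounds of the algorithm *)

(** The invariant at Step 3. Duplicate-freeness bounds the lists by N; [good_neg] also excludes
    negative edges between partners, that is, loops of the forcing graph. The cover is not known to
    be duplicate-free, so [good_cover] bounds its length by trading it against the remaining
    vertices. *)
Record good (pos : V -> seq V) (st : state V) : Prop := Good {
  good_verts : uniq (verts st);
  good_mate : {in verts st, forall x, mate pos x \in verts st};
  good_mateK : {in verts st, forall x, mate pos (mate pos x) = x};
  good_neg : forall x, uniq (neg st x) /\ mate pos x \notin neg st x;
  good_neg_verts : {in verts st, forall x, {subset neg st x <= verts st}};
  good_forbidden : uniq (forbidden st);
  good_groups : forall x, uniq (groups st x);
  good_cover : size (partial_cover st) + size (verts st) <= N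
}.

Definition progress pos (st st' : state V) : Prop :=
  good pos st' /\ size (verts st') < size (verts st).

Lemma size_filter_lt (T : eqType) (P : pred T) (s : seq T) (x : T) :
  x \in s -> ~~ P x -> size (filter P s) < size s.
Proof.
move=> x_s nPx; rewrite size_filter ltn_neqAle count_size andbT -all_count.
by apply/allPn; exists x.
Qed.

(** The survivors are the fixed points of [rep]. The third condition on [rep] closes them under
    partners, so the matching restricts to them; the moved vertex [x] gives the decrease. *)
Lemma within_identify_in (pos rep : V -> seq V) (st : state V) x :
  good pos st ->
  {in verts st, forall y, mate rep y \in verts st} ->
  {in verts st, forall y, mate rep (mate rep y) = mate rep y} ->
  {in verts st, forall y, mate rep y = y -> mate rep (mate pos y) = mate pos y} ->
  x \in verts st -> mate rep x != x ->
  within 24 (identify_in pos rep st) (progress pos st).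
Proof.
case: st => vs neg cov forb grp [/= Uvs mate_vs mateK Uneg neg_vs Uforb Ugrp le_cov].
move=> rep_vs repK rep_mate x_vs rep_x.
have le_neg y : size (neg y) <= N by apply: uniq_size_le; case: (Uneg y).
apply: within_bind (within_identify pos Uvs rep_vs repK le_neg neg_vs Ugrp) _ _ => //.
move=> [[vs' neg'] grp'] [/= -> Uneg' neg'_vs Ugrp']; apply: within_ret.
have lt_vs : size [seq y <- vs | y == mate rep y] < size vs.
  by apply: size_filter_lt x_vs _; rewrite eq_sym.
split=> //; split=> //=.
- exact: filter_uniq.
- by move=> y; rewrite !mem_filter => /andP[/eqP rep_y y_vs]; rewrite mate_vs // rep_mate ?eqxx.
- by move=> y; rewrite mem_filter => /andP[_]; apply: mateK.
- by apply: leq_trans le_cov; rewrite leq_add2l ltnW.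
Qed.

Lemma within_put_in_cover (pos : V -> seq V) (st : state V) x :
  good pos st -> x \in verts st ->
  within 20 (put_in_cover pos x st) (progress pos st).
Proof.
case: st => vs neg cov forb grp [/= Uvs mate_vs mateK Uneg neg_vs Uforb Ugrp le_cov] x_vs.
have le_neg y : size (neg y) <= N by apply: uniq_size_le; case: (Uneg y).
rewrite /put_in_cover; run; run; run.
apply: within_bind (within_union (le_neg x) Uforb) _ _ => // forb' Uforb'.
have run_keep y : yields 3 (let* b := eqv y x in let* b' := eqv y (mate pos x) in
    ret (~~ b && ~~ b')) ((y != x) && (y != mate pos x)).
    by run; run; apply: within_ret.
apply: bind_yields (within_select (uniq_size_le Uvs) (fun y _ => run_keep y)) _ _ => //.
set vs' := [seq y <- vs | _]; have Uvs' : uniq vs' by apply: filter_uniq.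
apply: within_bind (within_restrict run_keep (uniq_size_le Uvs') le_neg) _ _ => //.
move=> neg' [sub_neg' all_neg']; apply: within_ret.
have lt_vs : size vs' < size vs by apply: size_filter_lt x_vs _; rewrite eqxx.
split=> //; split=> //=.
(* As [mate pos] is an involution, the partner of a survivor is neither of the deleted vertices. *)
- move=> y; rewrite !mem_filter => /andP[/andP[y_x y_x'] y_vs]; rewrite mate_vs // andbT.
  apply/andP; split; first by apply: contraNneq y_x' => <-; rewrite mateK.
  by apply: contraNneq y_x => mate_y; rewrite -(mateK y) // mate_y mateK.
- by move=> y; rewrite mem_filter => /andP[_]; apply: mateK.
- move=> y; have [Uy y_mate] := Uneg y; split; first exact: subseq_uniq (sub_neg' y) Uy.
  by apply: contra y_mate => /(mem_subseq (sub_neg' y)).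
- move=> y y_vs' z z_y; rewrite mem_filter (allP (all_neg' y y_vs') z z_y).
  move: y_vs'; rewrite mem_filter => /andP[_ y_vs].
  exact: neg_vs y_vs _ (mem_subseq (sub_neg' y) z_y).
(* One vertex enters the cover while at least one leaves the graph. *)
- by rewrite addSn -addnS (leq_trans _ le_cov) // leq_add2l.
Qed.

(** * Cycles of the forcing graph *)

Lemma yields_up_to x l :
  size l <= N -> yields 3 (up_to x l) (take (index x l).+1 l).
Proof.
(* Level 0 is one unit, so this budget gives three units per element: advance, compare, push. *)
move=> le_l; apply: within_runs (iterated_level 0 le_l) _; rewrite expn0.
elim: l {le_l} => [|y l IHl]; first exact: runs_ret.
rewrite mulSn addSn; apply: runs_tick_bind; rewrite addSn -add1n.
apply: (runs_bind (P := fun b => b = (y == x))) => [|_ -> /=].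
  by apply: runs_tick_bind; apply: runs_ret.
case: (y == x); first by apply: runs_tick_bind; apply: runs_ret; rewrite take0.
rewrite addnC; apply: runs_bind IHl _ => _ ->.
by apply: runs_tick_bind; apply: runs_ret.
Qed.

(** The path is duplicate-free, which bounds the number of rounds. A vertex reached again is an
    out-neighbour of the top of the path and differs from it, as [F] has no loops. So the cycle has
    a vertex other than its head, and contracting it removes a vertex. *)
Lemma within_find_cycle (omega : nat -> bool) (F : V -> seq V) l root :
  (forall x, size (F x) <= N) ->
  {in l, forall x, [/\ F x != [::], x \notin F x & {subset F x <= l}]} ->
  root \in l ->
  within 8 (find_cycle omega F root) (fun c =>
    [/\ uniq c, {subset c <= l} & exists2 x, x \in c & x != head root c]).
Proof.
move=> le_F FP root_l.
pose I (pv : seq V * V) := [/\ uniq pv.1, {subset pv.1 <= l}, pv.2 \in l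
  & if pv.1 is x :: _ then pv.2 \in F x else true].
apply: (within_loop (j := 1) (k := 6) (I := I) (mu := fun pv => N - size pv.1)).
- move=> [path x] [/= Up path_l x_l x_path].
  apply: bind_yields (yields_member _ (uniq_size_le Up)) _ _ => //.
  case: ifP => [x_p|/negbT x_p].
    apply: bind_yields (yields_up_to _ (uniq_size_le Up)) _ _ => //; apply: within_ret.
    split; [exact: take_uniq | by move=> y /mem_take/path_l | exists x].
      case: path x_p {Up path_l x_path} => // y p x_p.
      by rewrite -[x in x \in _](nth_index x x_p) -(nth_take _ (ltnSn _)) mem_nth //
        size_takel // index_mem.
    case: path x_p x_path path_l {Up} => // y p _ x_Fy path_l; apply: contraTneq x_Fy => /= ->.
    by have [] := FP y (path_l y (mem_head _ _)).
  have [Fx_n0 x_Fx Fx_l] := FP x x_l; run.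
  apply: (within_bind (within_choose_from (k := 1) omega Fx_n0 _)) => // [|y y_Fx].
    by rewrite expn1; do 2 apply: leqW.
  run; apply: within_ret; split; first split => //=; first by rewrite x_p.
  + by move=> z; rewrite inE => /orP[/eqP->|/path_l].
  + exact: Fx_l.
  (* The truncated difference drops properly because the extended path still has at most N
     entries. *)
  + by rewrite ltn_sub2l // -[_ < _]/(size (x :: path) <= N) uniq_size_le //= x_p.
- by split.
- by rewrite subn0 expn1.
Qed.

Lemma within_forcing_graph (pos neg : V -> seq V) l :
  size l <= N -> (forall x, size (neg x) <= N) ->
  within 14 (forcing_graph pos l neg) (fun F =>
    (forall x, size (F x) <= N) /\ {in l, forall x, F x = map (mate pos) (neg x)}).
Proof.
move=> le_l le_neg.
pose I (r : seq V) (F : V -> seq V) :=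
  (forall x, size (F x) <= N) /\
  {in l, forall x, x \notin r -> F x = map (mate pos) (neg x)}.
apply: (within_le (leqnSn 13) (P := I [::])) => [|F [le_F FE]]; last first.
  by split=> // x x_l; apply: FE.
apply: within_for_each => // [|x r F [le_F FE]]; first by split=> // x ->.
run; apply: bind_yields (yields_map_list (le_neg x) (yields_first_of pos)) _ _ => //.
apply: within_le (yields_put _ _ _) _ => // _ ->; split=> [y|y y_l y_r].
  by case: eqP => // _; rewrite size_map.
by case: eqP => [->//|/eqP y_x]; rewrite FE // inE negb_or y_x.
Qed.

(** Each continuing branch reduces to [within_put_in_cover] or [within_identify_in]. The failed
    tests of Steps 9, 10 and 12 supply, in turn, nonempty out-lists, a root, and disjoint cycles. *)
Lemma within_round (omega : nat -> bool) (pos : V -> seq V) (st : state V) :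
  good pos st ->
  within 50 (round omega pos st)
    (fun r => if r is inl st' then progress pos st st' else True).
Proof.
move=> good_st; have := good_st.
case: st good_st => vs neg cov forb grp good_st.
case=> /= Uvs mate_vs mateK Uneg neg_vs Uforb Ugrp le_cov.
have le_neg x : size (neg x) <= N by apply: uniq_size_le; case: (Uneg x).
have le_vs := uniq_size_le Uvs; have le_forb := uniq_size_le Uforb.
have continue k (c : timed (state V)) :
    within k c (progress pos (State vs neg cov forb grp)) ->
    within k.+1 (let* st' := c in ret (inl st')) (fun r : state V + answer V =>
      if r is inl st' then progress pos (State vs neg cov forb grp) st' else True).
  by move=> run_c; apply: within_bind run_c _ _ => // st' ?; apply: within_ret.
have choose (P : pred V) : ~~ nilp (filter P vs) ->
    within 1 (choose_from omega (filter P vs)) (fun x => x \in vs).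
  move=> found; apply: within_le (within_choose_from (k := 1) omega _ _) _ => //.
  - by case: (filter P vs) found.
  - by rewrite expn1 ltnW // ltnW // ltnS ltnS uniq_size_le ?filter_uniq.
  by move=> x; rewrite mem_filter => /andP[].
cbv beta iota zeta delta [round].
apply: (bind_yields (j := 10)) => //.
  apply: within_exists_in => // x _; do 3 run; exact: within_ret.
case: ifP => _; first exact: within_ret.
apply: (bind_yields (j := 7)) => //.
  by apply: within_select => // x _; apply: yields_member.
case: ifP => [found|_].
  apply: continue; apply: (within_bind (choose _ found)) => // x x_vs; run.
  apply: (within_bind (within_put_in_cover good_st (mate_vs x x_vs))) => //.
  move=> [vs1 neg1 cov1 forb1 grp1] [[/= ? ? ? ? ? Uforb1 ? ?] lt_vs].
  apply: bind_yields (yields_remove x (uniq_size_le Uforb1)) _ _ => //.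
  by apply: within_ret; do !split=> //=; apply: filter_uniq.
have has_loop x : yields 5 (let* nx := get neg x in member x nx) (x \in neg x).
  by run; apply: yields_member.
apply: (bind_yields (j := 11)) => //.
  apply: within_exists_in => // x _; apply: bind_yields (has_loop x) _ _ => //; run.
  by apply: bind_yields (has_loop _) _ _ => //; apply: within_ret.
case: ifP => _; first exact: within_ret.
apply: (bind_yields (j := 8)) => //.
  by apply: within_select => // x _; apply: has_loop.
case: ifP => [found|_].
  apply: continue; apply: (within_bind (choose _ found)) => // x x_vs; run.
  by apply: within_le (within_put_in_cover good_st (mate_vs x x_vs)) _.
apply: (bind_yields (j := 12)) => //.
  apply: within_select => // x _; run; apply: within_exists_in => // z _; run.
  exact: yields_member.
case: ifP => [found|_].
  apply: continue; apply: (within_bind (choose _ found)) => // x x_vs; run.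
  by apply: within_le (within_put_in_cover good_st (mate_vs x x_vs)) _.
pose crossing (xz : V * V) :=
  [/\ xz.1 \in verts (State vs neg cov forb grp), xz.2 \in neg xz.1, xz.1 != xz.2 & xz.1 != mate pos xz.2].
(* Each vertex still to be scanned may contribute N candidates; [J] refines this to one candidate
   per neighbour still to be scanned. Hence the choice is made from at most N * N pairs. *)
pose I (r : seq V) (acc : seq (V * V)) :=
  [/\ size acc + size r * N <= N * N, {subset r <= vs} & {in acc, forall xz, crossing xz}].
apply: (within_bind (P := I [::]) (j := 20)) => //.
  apply: within_for_each => // [|x r acc [le_acc r_vs acc_ok]].
    by split; rewrite // leq_mul2r le_vs orbT.
  have x_vs : x \in vs by apply: r_vs; rewrite mem_head.
  do 3 run.
  pose J (r' : seq V) (acc : seq (V * V)) :=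
    [/\ size acc + size r' + size r * N <= N * N, {subset r' <= neg x}
      & {in acc, forall xz, crossing xz}].
  apply: (within_le (P := J [::]) (j := 10)) => // [|acc' [le_acc' _ acc'_ok]]; last first.
    split=> //; first by rewrite -[size acc']addn0.
    by move=> y y_r; apply: r_vs; rewrite inE y_r orbT.
  apply: within_for_each => // [|z r' acc' [le_acc' r'_x acc'_ok]].
    split=> //; apply: leq_trans le_acc; rewrite mulSn addnA !leq_add2r leq_add2l.
    exact: le_neg.
  have r'_sub : {subset r' <= neg x} by move=> y y_r'; apply: r'_x; rewrite inE y_r' orbT.
  run; apply: bind_yields (yields_member _ (le_neg _)) _ _ => //; do 2 run.
  case: ifP => [/and3P[_ x_z x_z']|_]; last first.
    apply: within_ret; split=> //; apply: leq_trans le_acc'.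
    by rewrite leq_add2r leq_add2l leqnSn.
  apply: within_le (yields_push _ _) _ => // _ ->; split=> //.
    by rewrite /= addSnnS.
  move=> xz; rewrite inE => /orP[/eqP->|/acc'_ok //].
  by split=> //; apply: r'_x; rewrite mem_head.
move=> found [le_found _ found_ok]; case: ifP => [found_n0|_].
  apply: continue; apply: (within_bind (within_choose_from (k := 2) omega _ _)) => //.
  - by case: (found) found_n0.
  - apply: leq_trans (leq_trans (leq_addr _ _) le_found) _; rewrite -mulnn.
    by apply: leq_mul; do 2 apply: leqW.
  move=> [x z] /found_ok[/= x_vs /(neg_vs x x_vs) z_vs x_z x_z'].
  do 2 run; apply: within_bind (within_new_array _ le_vs) _ _ => // rep repE; do 2 run.
  have {}repE y : mate rep y = y by rewrite /mate; case: (repE y) => [->|[->]].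
  set rep'' := fun y => _.
  have rep''E y : mate rep'' y =
      if y == z then mate pos x else if y == mate pos z then x else y.
    rewrite /mate /rep''; case: ifP => // _; case: ifP => // _; exact: repE.
  (* The targets [x] and its partner are not moved themselves, which makes the replacement
     idempotent. *)
  have x'_z : mate pos x != z by apply: contraNneq x_z' => <-; rewrite mateK.
  have x'_z' : mate pos x != mate pos z.
    by apply: contraNneq x_z => x'_z'; rewrite -(mateK x) // x'_z' mateK.
  apply: within_le (within_identify_in (x := z) good_st _ _ _ _ _) _ => //=.
  - by move=> y y_vs; rewrite rep''E; case: ifP => _; [apply: mate_vs|case: ifP].
  - move=> y y_vs; rewrite !rep''E.
    case: (eqVneq y z) => [_|y_z]; first by rewrite (negPf x'_z) (negPf x'_z').
    by case: (eqVneq y (mate pos z)) => [_|y_z']; rewrite ?(negPf x_z) ?(negPf x_z') ?(negPf y_z) ?(negPf y_z').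
  (* Exactly [z] and its partner move, so the fixed points are closed under partners. *)
  - move=> y y_vs; rewrite !rep''E.
    case: (eqVneq y z) => [->/eqP|y_z]; first by rewrite (negPf x'_z).
    case: (eqVneq y (mate pos z)) => [-> x_z'E|y_z' _]; first by rewrite x_z'E eqxx in x_z'.
    rewrite ifN; last by apply: contraNneq y_z' => <-; rewrite mateK.
    by rewrite ifN //; apply: contraNneq y_z => y'_z'; rewrite -(mateK y) // y'_z' mateK.
  - by rewrite rep''E eqxx.
apply: (bind_yields (j := 5)) => //.
  by apply: within_select => // x _; run; apply: within_ret.
case: ifP => [found1|/negbFE/nilP neg_n0].
  apply: continue; apply: (within_bind (choose _ found1)) => // x x_vs.
  by apply: within_le (within_put_in_cover good_st x_vs) _.
case: ifP => [_|vs_n0].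
  apply: (within_bind (P := fun c => uniq c) (j := 15)) => // [|c _]; last exact: within_ret.
  apply: within_for_each_in => // [|x c _ Uc].
    by apply: leq_trans le_cov; apply: leq_addr.
  run; exact: within_le (within_union (uniq_size_le (Ugrp x)) Uc) _.
apply: within_bind (within_forcing_graph pos le_vs le_neg) _ _ => // F [le_F FE].
have vs_not_nil : vs != [::] by case: (vs) vs_n0.
apply: (within_bind (within_choose_from (k := 1) omega vs_not_nil _)) => //.
  by rewrite expn1; do 2 apply: leqW.
move=> root root_vs.
(* Out-lists are nonempty because Step 9 found no vertex; a loop at [x] would be a negative edge
   from [x] to its partner. *)
have FP : {in vs, forall x, [/\ F x != [::], x \notin F x & {subset F x <= vs}]}.
  move=> x x_vs; rewrite FE //; split.
  - have : x \notin [seq x <- vs | nilp (neg x)] by rewrite neg_n0.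
    by rewrite mem_filter x_vs andbT; case: (neg x).
  - apply/mapP => -[w w_x x_w]; have [_ /negP[]] := Uneg x.
    by rewrite {1}x_w mateK // (neg_vs x).
  by move=> _ /mapP[w w_x ->]; apply/mate_vs/(neg_vs x).
apply: within_bind (within_find_cycle omega le_F FP root_vs) _ _ => //.
move=> cycle [Ucycle cycle_vs [y y_cycle y_c]]; have le_cycle := uniq_size_le Ucycle.
apply: bind_yields (yields_map_list le_cycle (yields_partner pos)) _ _ => //.
set cycle' := map _ cycle; have le_cycle' : size cycle' <= N by rewrite size_map.
apply: (bind_yields (j := 7)) => //.
  by apply: within_exists_in => // x _; apply: yields_member.
case: ifP => [_|/negbT/hasPn cycle_cycle']; first exact: within_ret.
apply: continue.
have c_cycle : head root cycle \in cycle by case: (cycle) y_cycle => // *; apply: mem_head.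
set c := head root cycle in y_c c_cycle *.
have c'_cycle' : mate pos c \in cycle' by apply: map_f.
apply: within_bind (within_new_array _ le_vs) _ _ => // rep repE; run.
have {}repE x : mate rep x = x by rewrite /mate; case: (repE x) => [->|[->]].
apply: within_bind (within_put_all [:: c] rep le_cycle) _ _ => // rep' rep'E.
apply: within_bind (within_put_all [:: mate pos c] rep' le_cycle') _ _ => // rep'' rep''E.
have {rep'E}rep''E x : mate rep'' x =
    if x \in cycle' then mate pos c else if x \in cycle then c else x.
  by rewrite /mate rep''E rep'E; case: ifP => // _; case: ifP => // _; apply: repE.
(* By disjointness, the cells written for the second cycle do not overwrite those of the first. *)
have cycleF x : x \in cycle -> (x \in cycle') = false by move/cycle_cycle'/negbTE.
(* The vertex [y], distinct from the head [c], is moved to [c]; this is the decrease. *)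
apply: within_le (within_identify_in (x := y) good_st _ _ _ _ _) _ => //=.
- move=> x x_vs; rewrite rep''E; case: ifP => _; first by rewrite mate_vs ?cycle_vs.
  by case: ifP => // _; apply: cycle_vs.
- move=> x _; rewrite !rep''E; case x_cycle': (x \in cycle'); first by rewrite c'_cycle'.
  case x_cycle: (x \in cycle); first by rewrite cycleF ?c_cycle.
  by rewrite x_cycle' x_cycle.
(* A fixed point is [c], the partner of [c], or a vertex outside both cycles; in each case its
   partner is fixed too. *)
- move=> x x_vs; rewrite !rep''E; case: ifP => [_ <-|x_cycle'].
    by rewrite mateK ?cycle_vs // cycleF // c_cycle.
  case: ifP => [_ <-|x_cycle _]; first by rewrite c'_cycle'.
  rewrite ifF; last first.
    apply/mapP => -[u u_cycle x'_u].
    by rewrite -(mateK x) // x'_u mateK ?cycle_vs ?u_cycle // in x_cycle.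
  rewrite ifF //; apply: contraFF x_cycle' => x'_cycle.
  by rewrite -(mateK x) //; apply: map_f.
- exact: cycle_vs.
- by rewrite rep''E cycleF // y_cycle eq_sym.
Qed.

Lemma within_rounds (omega : nat -> bool) (pos : V -> seq V) (st : state V) :
  good pos st -> within 52 (loop (round omega pos) st) xpredT.
Proof.
move=> good_st; apply: (within_loop (j := 1) (k := 50) (I := good pos)
  (mu := fun st => size (verts st))) => // [st' good_st'|].
  by apply: within_le (within_round omega good_st') _ => // -[].
rewrite expn1 ltnS; apply: leq_trans (leqnSn N).
exact: uniq_size_le (good_verts good_st).
Qed.

(** * The positive components *)

(** The invariant says that each neighbour of a newly visited vertex is either assigned to the
    opposite part or waiting on the stack with that part. Once the stack is empty, all these
    neighbours are visited. *)
Lemma within_dfs (pos rep0 : V -> seq V) x0 x1 :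
  (forall x, size (pos x) <= N) -> rep0 x0 = [::] -> x0 != x1 -> x1 \in pos x0 ->
  within 14 (Defs.dfs pos [:: (x0, x0, x1)] rep0) (fun o => if o is Some rep then
    [/\ forall x, rep0 x != [::] -> rep x = rep0 x,
        forall x, rep0 x = [::] -> rep x != [::] ->
          mate rep x \in [:: x0; x1] /\ {in pos x, forall y, rep y != [::]},
        ohead (rep x0) = Some x0 & ohead (rep x1) = Some x1] else True).
Proof.
move=> le_pos rep0_x0 x0_x1 x1_pos; pose part (b : bool) := if b then x0 else x1.
pose I (st : seq (V * V * V) * (V -> seq V)) :=
  [/\ forall x, rep0 x != [::] -> st.2 x = rep0 x,
      forall x, rep0 x = [::] -> st.2 x != [::] -> exists2 b, st.2 x = [:: part b]
        & {in pos x, forall y, ohead (st.2 y) = Some (part (~~ b)) \/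
            (y, part (~~ b), part b) \in st.1},
      {in st.1, forall e, exists b, e = (e.1.1, part b, part (~~ b))}
    & ohead (st.2 x0) = Some x0 \/ (x0, x0, x1) \in st.1].
(* A visit pushes at most N entries but uses up an unvisited vertex, worth N + 1; discarding an
   entry shortens the stack. *)
pose mu (st : seq (V * V * V) * (V -> seq V)) :=
  #|[pred x | nilp (st.2 x)]| * N.+1 + size st.1.
apply: (within_loop (j := 2) (k := 11) (I := I) (mu := mu)).
- move=> [[|[[x p] q] stack] rep] [/= rep_rep0 rep_new stack_part rep_x0].
    apply: within_ret; have {}rep_x0 : ohead (rep x0) = Some x0 by case: rep_x0.
    split=> // [x rep0_x rep_x|].
      have [b rep_xE rep_pos] := rep_new x rep0_x rep_x; split.
        by rewrite /mate rep_xE !inE /part /=; case: b {rep_xE rep_pos}; rewrite eqxx ?orbT.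
      by move=> y y_pos; case: (rep_pos y y_pos) => // rep_y; apply: contra_eq_neq rep_y => ->.
    (* The root carries [x0], which differs from [x1], so its neighbour [x1] carries the opposite
       part [x1]. *)
    have [|b] := rep_new x0 rep0_x0; first by case: (rep x0) rep_x0.
    move=> rep_x0E /(_ x1 x1_pos)[]//; move: rep_x0; rewrite rep_x0E /part.
    by case: (b) => //= -[x1_x0]; rewrite x1_x0 eqxx in x0_x1.
  have [b [pE qE]] := stack_part _ (mem_head _ _).
  run; case rep_x: (rep x) => [|p' r]; last first.
    run; case: eqP => [p_p'|_]; apply: within_ret => //; split; last first.
      by rewrite /mu /= ltn_add2l.
    (* What the discarded entry asked for is already recorded in [rep]. *)
    have popped y p1 q1 : (y, p1, q1) \in (x, p, q) :: stack ->
        ohead (rep y) = Some p1 \/ (y, p1, q1) \in stack.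
      by rewrite inE => /orP[/eqP[-> -> _]|]; [rewrite rep_x p_p'; left|right].
    split=> //= [y rep0_y rep_y||].
    + have [b' rep_yE rep_pos] := rep_new y rep0_y rep_y; exists b' => // z z_pos.
      by case: (rep_pos z z_pos) => [|/popped //]; left.
    + by move=> e e_stack; apply: stack_part; rewrite inE e_stack orbT.
    + by case: rep_x0 => [|/popped //]; left.
  run; run; have run_push := yields_for_each_push (k := 1) (g := fun w => (w, q, p)) stack (le_pos x).
  apply: bind_yields (run_push _ _) _ _ => // [w s|]; first exact: yields_push.
  apply: within_ret; rewrite catrevE.
  set rep' := fun y => if _ then _ else _; set stack' := _ ++ _.
  have stack'_old e : e \in stack -> e \in stack' by rewrite mem_cat => ->; rewrite orbT.
  have stack'_new y : y \in pos x -> (y, q, p) \in stack'.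
    by move=> y_pos; rewrite mem_cat mem_rev map_f.
  have pushed y p1 q1 : ohead (rep y) = Some p1 \/ (y, p1, q1) \in (x, p, q) :: stack ->
      ohead (rep' y) = Some p1 \/ (y, p1, q1) \in stack'.
    rewrite /rep'; case: eqP => [->|y_x]; rewrite ?rep_x inE.
      by case=> // /orP[/eqP[-> _]|/stack'_old]; [left|right].
    by case=> [|/orP[/eqP[/y_x]|/stack'_old]] //; [left|right].
  split.
    split=> /= [y rep0_y|y rep0_y rep'_y||]; last exact: pushed.
    + rewrite /rep'; case: eqP => [y_x|_]; last exact: rep_rep0.
      by have := rep_rep0 y rep0_y; move: rep0_y; rewrite y_x rep_x => /eqP + /esym.
    + case: (eqVneq y x) => [->|y_x].
        exists b => [|z z_pos]; first by rewrite /rep' eqxx pE.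
        by right; rewrite -pE -qE; apply: stack'_new.
      have rep_y : rep y != [::] by rewrite /rep' (negPf y_x) in rep'_y.
      rewrite {1}/rep' (negPf y_x).
      have [b' rep_yE rep_pos] := rep_new y rep0_y rep_y; exists b' => // z z_pos.
      exact: pushed (rep_pos z z_pos).
    + move=> e; rewrite mem_cat mem_rev => /orP[/mapP[y _ ->]|e_stack] /=.
        by exists (~~ b); rewrite negbK -pE -qE.
      by apply: stack_part; rewrite inE e_stack orbT.
  rewrite /mu /= size_cat size_rev size_map addnS ltnS addnA leq_add2r.
  apply: leq_trans (_ : #|[pred y | nilp (rep' y)]|.+1 * N.+1 <= _).
    by rewrite mulSnr leq_add2l (leq_trans (le_pos x)).
  rewrite leq_mul2r; apply/orP; right; apply: proper_card; apply/properP; split.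
    by apply/subsetP => y; rewrite !inE /rep'; case: eqP.
  by exists x; rewrite inE /rep' ?rep_x // eqxx.
- split=> /= [//|x -> //||]; last by right; rewrite mem_head.
  by move=> e; rewrite inE => /eqP->; exists true.
(* Initially the measure is at most N * (N + 1) + 1, which is below the square of N + 2. *)
- have le_card : #|[pred x | nilp (rep0 x)]| <= N by apply: leq_trans (max_card _) card_le.
  rewrite /mu /= addn1 -mulnn.
  apply: leq_trans (_ : (N * N.+1).+2 <= _); first by rewrite !ltnS leq_mul2r le_card orbT.
  have le_sum := leq_add (leq_mul (leqnn N) (leqnSn N.+1)) (leq_pmulr 2 (ltn0Sn N.+1)).
  by rewrite -[_.+2]addn2 (leq_trans le_sum) // -mulnDl addn2.
Qed.

Definition pair_has x (xy : V * V) := (x == xy.1) || (x == xy.2).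

(* [ps] lists, without overlap, the two replacements in each component visited
   so far. *)
Definition good_pairs (pos : V -> seq V) l (rep : V -> seq V) (ps : seq (V * V)) :=
  [/\ forall x, rep x != [::] -> has (pair_has (mate rep x)) ps,
      forall x, has (pair_has x) ps -> [/\ rep x != [::], mate rep x = x & x \in l],
      forall x, rep x != [::] -> {in pos x, forall y, rep y != [::]},
      {in ps, forall xy, xy.1 != xy.2}
    & forall x, {in ps &, forall xy zw, pair_has x xy -> pair_has x zw -> xy = zw}].

(** Visited vertices are closed under positive neighbours. By symmetry the first neighbour of an
    unvisited root is then unvisited, so the new pair is disjoint from the earlier ones, whose
    members are all visited. Each root adds at most one pair. *)
Lemma within_bipartition (pos : V -> seq V) l :
  uniq l -> (forall x, size (pos x) <= N) -> symmetric_lists pos ->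
  (forall x, (x \in l) = (pos x != [::])) ->
  within 26 (bipartition pos l) (fun o => if o is Some (rep, ps) then
    [/\ good_pairs pos l rep ps, {in l, forall x, rep x != [::]} & size ps <= N]
    else True).
Proof.
move=> Ul le_pos sym_pos lE; have le_l := uniq_size_le Ul.
apply: within_bind (within_new_array _ le_l) _ _ => // rep0 rep0E.
have {}rep0E x : rep0 x = [::] by case: (rep0E x) => [|[]].
pose I (r : seq V) (o : option ((V -> seq V) * seq (V * V))) :=
  {subset r <= l} /\ if o is Some (rep, ps) then
    [/\ good_pairs pos l rep ps, {in l, forall x, x \notin r -> rep x != [::]}
      & size ps + size r <= N]
    else True.
apply: (within_le (P := I [::]) (j := 23)) => // [|[[rep ps]|//] [_ [ok rep_l le_ps]]]; last first.
  by split=> // [x x_l|]; [apply: rep_l|rewrite -[size ps]addn0].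
apply: within_for_each => // [|x r [[rep ps]|] [r_l]].
- split=> //; split=> // [|x ->//].
  by split=> // x; rewrite rep0E.
- move=> [ok rep_l le_ps].
  have x_l : x \in l by apply: r_l; rewrite mem_head.
  have {}r_l : {subset r <= l} by move=> y y_r; apply: r_l; rewrite inE y_r orbT.
  run; case rep_x: (rep x) => [|p s]; last first.
    apply: within_ret; split=> //; split=> // [y y_l y_r|]; last first.
      by apply: leq_trans le_ps; rewrite leq_add2l.
    by case: (eqVneq y x) => [->|y_x]; [rewrite rep_x|rewrite rep_l // inE negb_or y_x].
  run; run; case: eqP => [_|/eqP x_y]; first exact: within_ret.
  set y := mate pos x in x_y *.
  have y_pos : y \in pos x.
    by move: x_l; rewrite lE /y /mate; case: (pos x) => // *; apply: mem_head.
  have [rep_ps ps_rep rep_pos ps_neq ps_inj] := ok.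
  have rep_y : rep y = [::].
    by apply/eqP/negPn/negP => /rep_pos/(_ x (sym_pos _ _ y_pos)); rewrite rep_x.
  have y_l : y \in l by rewrite lE; apply/eqP => pos_y; have := sym_pos _ _ y_pos; rewrite pos_y.
  apply: within_bind (within_dfs le_pos rep_x x_y y_pos) _ _ => // -[rep'|_]; last exact: within_ret.
  move=> [rep'_rep rep'_new rep'_x rep'_y]; run; apply: within_ret.
  have visited z : rep z != [::] -> rep' z != [::] by move=> rep_z; rewrite rep'_rep.
  split=> //; split; last by rewrite addSnnS.
    split.
    + move=> z rep'_z; case: (eqVneq (rep z) [::]) => [rep_z|rep_z] /=.
        have [+ _] := rep'_new z rep_z rep'_z; rewrite !inE /pair_has /=.
        by move=> ->.
      by rewrite /mate rep'_rep // rep_ps ?orbT.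
    + move=> z /= /orP[|/ps_rep[rep_z rep_zE z_l]]; last first.
        by rewrite /mate rep'_rep.
      by case/orP => /= /eqP->; [move: rep'_x|move: rep'_y]; rewrite /mate; case: (rep' _) => //= z' t [->].
    + move=> z rep'_z w w_z; case: (eqVneq (rep z) [::]) => [rep_z|rep_z].
        by have [_] := rep'_new z rep_z rep'_z; apply.
      exact/visited/(rep_pos z).
    + by move=> zw; rewrite inE => /orP[/eqP->//|/ps_neq].
    + have fresh z zw : zw \in ps -> pair_has z (x, y) -> ~~ pair_has z zw.
        move=> zw_ps z_xy; apply/negP => z_zw.
        have [] := ps_rep z; first by apply/hasP; exists zw.
        by case/orP: z_xy => /= /eqP->; rewrite ?rep_x ?rep_y.
      move=> z xy zw; rewrite !inE => /orP[/eqP->|xy_ps] /orP[/eqP->|zw_ps] //.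
      * by move=> /(fresh z zw zw_ps)/negP.
      * by move=> + /(fresh z xy xy_ps)/negP.
      * exact: ps_inj.
  move=> z z_l z_r; case: (eqVneq z x) => [->|z_x]; first by case: (rep' x) rep'_x.
  by apply/visited/rep_l; rewrite // inE negb_or z_x.
- by move=> _; apply: within_ret; split=> // y y_r; apply: r_l; rewrite inE y_r orbT.
Qed.

(** Every surviving representative belongs to one of the pairs, and as these do not overlap, the
    rewritten positive lists match each pair; this gives the involution required by [good]. *)
Lemma within_preparation l (ep en : seq (V * V)) :
  uniq l -> (forall x, x \in l) -> size ep <= N -> size en <= N ->
  within 40 (preparation l ep en)
    (fun o => if o is Some (pos, st) then good pos st else True).
Proof.
move=> Ul lT le_ep le_en; have le_l := uniq_size_le Ul; rewrite /preparation.
apply: within_bind (within_adjacency le_l le_ep) _ _ => // pos [le_pos sym_pos].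
apply: within_bind (within_adjacency le_l le_en) _ _ => // neg [le_neg _].
apply: within_bind (within_new_array _ le_l) _ _ => // grp grpE.
have {}grpE x : uniq (grp x) by case: (grpE x) => [->|[->]].
have in_Vplus x : yields 2 (let* nx := get pos x in ret (~~ nilp nx)) (~~ nilp (pos x)).
  by run; apply: within_ret.
apply: bind_yields (within_select le_l (fun x _ => in_Vplus x)) _ _ => //.
set l1 := [seq x <- l | _]; have Ul1 : uniq l1 by apply: filter_uniq.
have l1E x : (x \in l1) = (pos x != [::]) by rewrite mem_filter lT andbT; case: (pos x).
have le_l1 := uniq_size_le Ul1.
apply: within_bind (within_restrict in_Vplus le_l1 le_neg) _ _ => //.
move=> neg1 [neg1_neg neg1_l1].
apply: within_bind (within_bipartition Ul1 le_pos sym_pos l1E) _ _ => //.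
move=> [[rep ps]|_]; last exact: within_ret.
move=> [[rep_ps ps_rep rep_pos ps_neq ps_inj] rep_l1 le_ps].
pose matched (p : V -> seq V) (xy : V * V) := mate p xy.1 = xy.2 /\ mate p xy.2 = xy.1.
pose I (r : seq (V * V)) (p : V -> seq V) :=
  {subset r <= ps} /\ {in ps, forall xy, xy \notin r -> matched p xy}.
apply: (within_bind (P := I [::]) (j := 10)) => // [|pos2 [_ pos2_ps]].
  apply: within_for_each => // [|[x y] r p [r_ps p_ps]]; first by split=> // xy ->.
  run; apply: within_le (yields_put _ _ _) _ => // _ ->.
  have xy_ps : (x, y) \in ps by apply: r_ps; rewrite mem_head.
  have x_y : x != y := ps_neq _ xy_ps.
  split=> [xy xy_r|zw zw_ps zw_r]; first by apply: r_ps; rewrite inE xy_r orbT.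
  case: (eqVneq zw (x, y)) => [->|zw_xy].
    by rewrite /matched /mate /= !eqxx (negPf x_y).
  (* A vertex of another pair is neither [x] nor [y], so its cell is not overwritten. *)
  have fresh z : pair_has z zw -> (z == x = false) * (z == y = false).
    move=> z_zw; split; apply: contra_neqF zw_xy => /eqP z_xy;
      by apply: (ps_inj z); rewrite // /pair_has z_xy eqxx ?orbT.
  rewrite /matched /mate !fresh ?/pair_has ?eqxx ?orbT //.
  by apply: p_ps; rewrite // inE negb_or zw_xy.
have matched_ps xy : xy \in ps -> matched pos2 xy by move=> xy_ps; apply: pos2_ps.
have ps_mate x : has (pair_has x) ps ->
    has (pair_has (mate pos2 x)) ps /\ mate pos2 (mate pos2 x) = x.
  move=> /hasP[xy xy_ps /orP[]/eqP->]; have [xE yE] := matched_ps xy xy_ps.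
    by rewrite xE yE; split=> //; apply/hasP; exists xy; rewrite // /pair_has eqxx orbT.
  by rewrite yE xE; split=> //; apply/hasP; exists xy; rewrite // /pair_has eqxx.
have rep_in : {in l1, forall x, mate rep x \in l1}.
  by move=> x /rep_l1/rep_ps/ps_rep[].
have repK : {in l1, forall x, mate rep (mate rep x) = mate rep x}.
  by move=> x /rep_l1/rep_ps/ps_rep[].
have le_neg1 x : size (neg1 x) <= N by apply: leq_trans (size_subseq (neg1_neg x)) (le_neg x).
have neg1_in : {in l1, forall x, {subset neg1 x <= l1}}.
  by move=> x x_l1 y y_x; rewrite mem_filter lT (allP (neg1_l1 x x_l1) y y_x).
apply: within_bind (within_identify pos2 Ul1 rep_in repK le_neg1 neg1_in grpE) _ _ => //.
move=> [[l2 neg2] grp2] [/= -> neg2_uniq neg2_l2 grp2_uniq]; apply: within_ret.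
have rep_fix x : x \in [seq x <- l1 | x == mate rep x] -> has (pair_has x) ps.
  by rewrite mem_filter => /andP[/eqP x_rep /rep_l1/rep_ps]; rewrite -x_rep.
split=> //=.
- exact: filter_uniq.
- by move=> x /rep_fix/ps_mate[/ps_rep[_ rep_x' x'_l1] _]; rewrite mem_filter rep_x' eqxx.
- by move=> x /rep_fix/ps_mate[].
- by rewrite add0n; apply: uniq_size_le; apply: filter_uniq.
Qed.

(** * The whole algorithm and its polynomial bound *)

Lemma within_MaxDef (omega : nat -> bool) l (ep en : seq (V * V)) :
  uniq l -> (forall x, x \in l) -> size ep <= N -> size en <= N ->
  within 53 (MaxDef omega l ep en) xpredT.
Proof.
move=> Ul lT le_ep le_en.
apply: within_bind (within_preparation Ul lT le_ep le_en) _ _ => //.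
by move=> [[pos st] good_st|_]; [apply: within_rounds|apply: within_ret].
Qed.

End Arrays.

End Levels.

Theorem corollary4p2 :
  exists p : {poly nat},
    forall (G : sgraph) (vs : seq (vertex G))
           (ep en : seq (vertex G * vertex G)),
      chromatic_number_is G 3 ->
      no_multiple_edges_of_same_sign G ->
      input_of vs ep en ->
      forall omega : nat -> bool,
        halts_within (MaxDef omega vs ep en)
                     (p.[(size vs + (size ep + size en))%N])%R.
Proof.
(* The polynomial is the level of [within_MaxDef], with N the input size, which bounds the number of
   vertices and both edge lists. *)
exists (('X + 2%N%:P) ^+ 53)%R => G vs ep en _ _ [vs_enum _ _] omega.
set N := _ + _; rewrite horner_exp hornerD hornerX hornerC natrXE natrDE addn2.
have card_le : #|vertex G| <= N by rewrite cardE -(perm_size vs_enum) leq_addr.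
have Uvs : uniq vs by rewrite (perm_uniq vs_enum) enum_uniq.
have vsT x : x \in vs by rewrite (perm_mem vs_enum) mem_enum.
have le_ep : size ep <= N by rewrite /N addnCA leq_addr.
have le_en : size en <= N by rewrite /N addnA leq_addl.
have [a [t [eq_a _ _]]] := within_MaxDef card_le omega Uvs vsT le_ep le_en 0.
by exists a, t; rewrite -eq_a addn0.
Qed.
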